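(* Let $E$ be an effect algebra with (RDP). Then every measure $m$ on $E$ can be uniquely expressed in the form $m=m_1+m_2$, where $m_1\in\mathcal M^+(E)_{\rm ca}$ and $m_2$ is a (finitely additive) measure on $E$ such that if $t\in\mathcal M^+(E)_{\rm ca}$ and $t\le^+m_2$, then $t=0$. In particular, every state $s$ on $E$ can be uniquely expressed as a convex combination $s=\lambda_1s_1+\lambda_2s_2$, where $s_1$ is a completely additive state and $s_2$ is a (finitely additive) state such that if $\alpha s'\le^+s_2$ for some completely additive state $s'$ on $E$ and some constant $\alpha\ge 0$, then $\alpha=0$.
   Context: An effect algebra is a partial algebra $(E;+,0,1)$ with a partial binary operation $+$ that is commutative ($a+b$ is defined iff $b+a$ is, and then they are equal) and constants $0,1$ such that for all $a,b,c\in E$: (i) $a+b$ and $(a+b)+c$ exist iff $b+c$ and $a+(b+c)$ exist, and then $(a+b)+c=a+(b+c)$; (ii) there is exactly one $d\in E$ with $a+d=1$; (iii) if $1+a$ exists, then $a=0$. The partial order is $a\le b$ iff $a+c=b$ for some $c\in E$. $E$ has (RDP) if whenever $a_1+a_2=b_1+b_2$ (both sums defined), there are $d_1,d_2,d_3,d_4\in E$ with $d_1+d_2=a_1$, $d_3+d_4=a_2$, $d_1+d_3=b_1$, $d_2+d_4=b_2$. A measure on $E$ is a map $m:E\to[0,\infty)$ with $m(a+b)=m(a)+m(b)$ whenever $a+b$ is defined; a state is a measure with $s(1)=1$. $m_1\le^+m_2$ means $m_1(a)\le m_2(a)$ for all $a\in E$. A system $\{a_t\}_{t\in T}$ in $E$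 is summable if $a_F=\sum_{t\in F}a_t$ is defined for each finite $F\subseteq T$; if $a=\bigvee\{a_F:F\subseteq T\text{ finite}\}$ exists in $E$, write $a=\sum_{t\in T}a_t$. A measure $m$ is completely additive if $m(a)=\sum_{t\in T}m(a_t)$ whenever $a=\sum_{t\in T}a_t$. $\mathcal M^+(E)_{\rm ca}$ is the set of completely additive measures on $E$. Convex combination means $\lambda_1,\lambda_2\ge0$, $\lambda_1+\lambda_2=1$. Uniqueness of the convex combination means: the coefficients $\lambda_i$ are uniquely determined, and $s_i$ is uniquely determined whenever $\lambda_i>0$; a term with coefficient $0$ may be omitted (relevant when no state of the required kind exists). *)

(* Defs.v *)
From HB Require Import structures.
From mathcomp Require Import all_boot all_order all_algebra.
From mathcomp Require Import finmap.
From mathcomp Require Import all_classical all_reals all_analysis.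

Set Implicit Arguments.
Unset Strict Implicit.
Unset Printing Implicit Defensive.

Import Order.TTheory GRing.Theory Num.Theory.
Local Open Scope ring_scope.

(* The partial sum is option-valued: [eadd a b = None] means that a + b is
   undefined.  In [eaddA] both sides are [None] when one of the sums involved
   is undefined, so the equation says that one side exists iff the other does,
   and that they then agree. *)
HB.mixin Record isEffectAlgebra (E : Type) := {
  eadd : E -> E -> option E;
  ezero : E;
  eone : E;
  eaddC : forall a b, eadd a b = eadd b a;
  eaddA : forall a b c,
    obind (fun ab => eadd ab c) (eadd a b) =
    obind (fun bc => eadd a bc) (eadd b c);
  eorthosupp : forall a, exists! d, eadd a d = Some eone;
  eadd1_eq0 : forall a b, eadd eone a = Some b -> a = ezero
}.

#[short(type="effectAlgebraType")]
HB.structure Definition EffectAlgebra := {E of isEffectAlgebra E}.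

Arguments ezero {s}.
Arguments eone {s}.

Definition ele (E : effectAlgebraType) (a b : E) : Prop :=
  exists c, eadd a c = Some b.

Definition rdp (E : effectAlgebraType) : Prop :=
  forall a1 a2 b1 b2 c : E,
    eadd a1 a2 = Some c -> eadd b1 b2 = Some c ->
    exists d1 d2 d3 d4 : E,
      [/\ eadd d1 d2 = Some a1, eadd d3 d4 = Some a2,
          eadd d1 d3 = Some b1 & eadd d2 d4 = Some b2].

Definition oadd (E : effectAlgebraType) (x y : option E) : option E :=
  obind (fun a => obind (eadd a) y) x.

Definition efsum (E : effectAlgebraType) (T : choiceType) (a : T -> E)
    (F : {fset T}) : option E :=
  \big[@oadd E/Some ezero]_(t <- F) Some (a t).

Definition esummable (E : effectAlgebraType) (T : choiceType) (a : T -> E) :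
    Prop :=
  forall F : {fset T}, exists aF, efsum a F = Some aF.

Definition is_esum (E : effectAlgebraType) (T : choiceType) (a : T -> E)
    (x : E) : Prop :=
  [/\ esummable a,
      forall F aF, efsum a F = Some aF -> ele aF x &
      forall y, (forall F aF, efsum a F = Some aF -> ele aF y) -> ele x y].

Section Measures.
Variables (R : realType) (E : effectAlgebraType).
Implicit Types m s : E -> R.

Definition is_measure m : Prop :=
  (forall a, 0 <= m a) /\
  (forall a b c, eadd a b = Some c -> m c = m a + m b).

Definition is_state s : Prop := is_measure s /\ s eone = 1.

Definition mle m1 m2 : Prop := forall a, m1 a <= m2 a.

Definition completely_additive m : Prop :=
  forall (T : choiceType) (a : T -> E) (x : E),
    is_esum a x -> (m x)%:E = (\esum_(t in [set: T]) (m (a t))%:E)%E.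

Definition ca_measure m : Prop := is_measure m /\ completely_additive m.

Definition ca_state s : Prop := is_state s /\ completely_additive s.

Definition ca_free_measure m : Prop :=
  is_measure m /\ forall t, ca_measure t -> mle t m -> t = (fun=> 0).

Definition ca_free_state s : Prop :=
  is_state s /\
  forall s' (alpha : R),
    ca_state s' -> 0 <= alpha -> mle (fun a => alpha * s' a) s -> alpha = 0.

(* A state is only required where its coefficient is nonzero: a term with
   coefficient 0 is absent, and the function attached to it is irrelevant. *)
Definition ca_convex_decomposition s (l1 l2 : R) s1 s2 : Prop :=
  [/\ 0 <= l1, 0 <= l2 & l1 + l2 = 1] /\
  [/\ 0 < l1 -> ca_state s1, 0 < l2 -> ca_free_state s2 &
      s = (fun a => l1 * s1 a + l2 * s2 a)].

End Measures.

(* Main.v *)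
(** By (RDP) any two measures have a join
    [(t1 v t2)(x) = sup {t1 a + t2 b | a + b = x}].  The completely additive
    measures are closed under sums and under passing to smaller measures, so,
    the join being below [t1 + t2], those below [m] form an upward directed set.
    Their pointwise supremum [m1] is therefore additive, and completely additive
    since suprema commute; it is the largest completely additive measure below
    [m], which makes [m - m1] free of completely additive parts.  If
    [m = n1 + n2] is another decomposition, then [m1 - n1] is a completely
    additive measure below [n2], hence zero.  The statement on states follows
    by normalising at [1]. *)
Require Import Defs.
From HB Require Import structures.
From mathcomp Require Import all_boot all_order all_algebra.
From mathcomp Require Import finmap lra.
From mathcomp Require Import all_classical all_reals all_analysis.

Import Order.TTheory GRing.Theory Num.Theory.
Local Open Scope ring_scope.

(** * Arithmetic of the partial sum *)

Section EffectAlgebraTheory.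
Variable E : effectAlgebraType.

Lemma eadd_assocr {a b c ab x : E} :
  eadd a b = Some ab -> eadd ab c = Some x ->
  exists2 bc, eadd b c = Some bc & eadd a bc = Some x.
Proof.
move=> ab_def abc_def; have := eaddA a b c.
rewrite ab_def /= abc_def; case: (eadd b c) => [bc|] //= ->.
by exists bc.
Qed.

Lemma eadd_assocl {a b c bc x : E} :
  eadd b c = Some bc -> eadd a bc = Some x ->
  exists2 ab, eadd a b = Some ab & eadd ab c = Some x.
Proof.
rewrite eaddC (eaddC a) => cb bca; have [ba ba_def cba] := eadd_assocr cb bca.
by exists ba; rewrite eaddC.
Qed.

(** Reassociate to bring [b1] next to [a2], swap them, and reassociate back; each move also yields
    definedness of the new sums. This later merges splittings of two summands into one splitting of
    their sum. *)
Lemma eadd_interchange {a1 b1 a2 b2 x1 x2 x : E} :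
  eadd a1 b1 = Some x1 -> eadd a2 b2 = Some x2 -> eadd x1 x2 = Some x ->
  exists a b, [/\ eadd a1 a2 = Some a, eadd b1 b2 = Some b & eadd a b = Some x].
Proof.
move=> e1 e2 e; have [y e3 e4] := eadd_assocr e1 e.
have [z e5 e6] := eadd_assocl e2 e3.
rewrite eaddC in e5; have [b e7 e8] := eadd_assocr e5 e6.
by have [a e9 e10] := eadd_assocl e8 e4; exists a, b.
Qed.

Lemma eadd10 : eadd eone ezero = Some (eone : E).
Proof. by have [d [d1 _]] := eorthosupp (eone : E); rewrite -{1}(eadd1_eq0 _ _ d1). Qed.

(** If [d] is the orthosupplement of [x], then adding 0 to [d + x = 1] shows that [x + 0] and [x]
    are both orthosupplements of [d], so they coincide. *)
Lemma eadd0 (x : E) : eadd x ezero = Some x.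
Proof.
have [d [xd _]] := eorthosupp x; have [x' [_ uniq_x']] := eorthosupp d.
have dx : eadd d x = Some eone by rewrite eaddC.
have [y -> dy] := eadd_assocr dx eadd10.
by rewrite -(uniq_x' _ dx) (uniq_x' _ dy).
Qed.

Lemma ele1 (x : E) : ele x eone.
Proof. by have [d [xd _]] := eorthosupp x; exists d. Qed.

End EffectAlgebraTheory.

(** * Finitely and completely additive measures *)

Section MeasureTheory.
Local Open Scope classical_set_scope.
Context {R : realType} {E : effectAlgebraType}.
Implicit Types m s t : E -> R.

Lemma measure_ele m a b : is_measure m -> ele a b -> m a <= m b.
Proof. by move=> [m_ge0 mD] [c /mD ->]; rewrite lerDl. Qed.

Lemma measure_le1 m a : is_measure m -> m a <= m eone.
Proof. by move=> mm; apply: measure_ele => //; exact: ele1. Qed.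

Lemma measure0 m : is_measure m -> m ezero = 0.
Proof. by move=> [_ mD]; have := mD _ _ _ (eadd10 E); lra. Qed.

Lemma measure1_eq0 m : is_measure m -> m eone = 0 -> m = (fun=> 0).
Proof.
move=> mm m1; apply/funext => a; apply/eqP.
by rewrite eq_le -{1}m1 measure_le1 // mm.1.
Qed.

Lemma measure_efsum m (T : choiceType) (a : T -> E) (F : {fset T}) x :
  is_measure m -> efsum a F = Some x -> m x = \sum_(t <- F) m (a t).
Proof.
move=> mm; rewrite /efsum; elim: (enum_fset F) x => [|t s IHs] x.
  by rewrite !big_nil => -[<-]; exact: measure0.
rewrite !big_cons.
by case: (\big[_/_]_(_ <- s) _) IHs => [y|] IHs //= /mm.2 ->; rewrite (IHs y).
Qed.

Lemma measure_sum_le m (T : choiceType) (a : T -> E) x (F : {fset T}) :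
  is_measure m -> is_esum a x -> \sum_(t <- F) m (a t) <= m x.
Proof.
move=> mm [a_summable ax _]; have [y Fy] := a_summable F.
by rewrite -(measure_efsum _ _ _ _ _ mm Fy); apply: measure_ele => //; exact: ax Fy.
Qed.

(** Finite additivity already bounds all partial sums by [m x], so only the inequality from [m x] to
    the sum has content. This form stays within the reals. *)
Lemma completely_additiveP m : is_measure m ->
  completely_additive m <->
  forall (T : choiceType) (a : T -> E) x r, is_esum a x ->
    (forall F : {fset T}, \sum_(t <- F) m (a t) <= r) -> m x <= r.
Proof.
move=> mm; split=> [mca T a x r ax sum_le|mca T a x ax].
  rewrite -lee_fin (mca _ _ _ ax); apply: ge_ereal_sup => _ [X [finX _] <-].
  by rewrite fsbig_finite // sumEFin lee_fin.
have sumle (F : {fset T}) :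
    ((\sum_(t <- F) m (a t))%:E <= \esum_(t in [set: T]) (m (a t))%:E)%E.
  apply: esum_ge; exists [set` F]; first by split.
  by rewrite fsbig_finite // set_fsetK sumEFin.
have sum_le : (\esum_(t in [set: T]) (m (a t))%:E <= (m x)%:E)%E.
  apply: ge_ereal_sup => _ [X [finX _] <-].
  by rewrite fsbig_finite // sumEFin lee_fin measure_sum_le.
apply/eqP; rewrite eq_le sum_le andbT.
move: sumle sum_le; case: (\esum_(_ in _) _)%E => [r| |] // sumle _.
  by rewrite lee_fin; apply: mca ax _ => F; rewrite -lee_fin.
(* The empty partial sum rules out the value minus infinity. *)
by have := sumle fset0.
Qed.

Lemma measureD m1 m2 :
  is_measure m1 -> is_measure m2 -> is_measure (fun a => m1 a + m2 a).
Proof.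
move=> [p1 a1] [p2 a2]; split=> [a|a b c abc]; first exact: addr_ge0.
by rewrite (a1 _ _ _ abc) (a2 _ _ _ abc) addrACA.
Qed.

Lemma measureB m1 m2 :
  is_measure m1 -> is_measure m2 -> mle m2 m1 -> is_measure (fun a => m1 a - m2 a).
Proof.
move=> [p1 a1] [p2 a2] le21; split=> [a|a b c abc]; first by rewrite subr_ge0.
by rewrite (a1 _ _ _ abc) (a2 _ _ _ abc); lra.
Qed.

Lemma measureZ (k : R) m :
  0 <= k -> is_measure m -> is_measure (fun a => k * m a).
Proof.
move=> k0 [p a]; split=> [x|x y z xyz]; first by rewrite mulr_ge0.
by rewrite (a _ _ _ xyz) mulrDr.
Qed.

Lemma measure_cst0 : is_measure ((fun=> 0) : E -> R).
Proof. by split=> // *; rewrite addr0. Qed.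

Lemma ca_measure_cst0 : ca_measure ((fun=> 0) : E -> R).
Proof. by split; [exact: measure_cst0 | move=> T a x _; rewrite esum1]. Qed.

Lemma ca_measureD m1 m2 :
  ca_measure m1 -> ca_measure m2 -> ca_measure (fun a => m1 a + m2 a).
Proof.
move=> [mm1 c1] [mm2 c2]; split; first exact: measureD.
move=> T a x ax; rewrite EFinD (c1 _ _ _ ax) (c2 _ _ _ ax) -esumD //.
- by move=> i _; rewrite lee_fin mm1.1.
- by move=> i _; rewrite lee_fin mm2.1.
Qed.

Lemma ca_measureZ (k : R) m :
  0 <= k -> ca_measure m -> ca_measure (fun a => k * m a).
Proof.
rewrite le_eqVlt => /predU1P[<- _|k0 [mm mca]].
  by under eq_fun do rewrite mul0r; exact: ca_measure_cst0.
have kmm := measureZ _ _ (ltW k0) mm.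
split=> //; apply/(completely_additiveP _ kmm) => T a x r ax sum_le.
rewrite -ler_pdivlMl //.
apply: ((completely_additiveP _ mm).1 mca _ _ _ _ ax) => F.
by rewrite ler_pdivlMl // mulr_sumr.
Qed.

(** The partial sums of the measure [m - t] are at most [m x - t x]. Adding this to a bound [r] for
    those of [t] bounds those of [m], and complete additivity of [m] then gives [t x <= r]. *)
Lemma ca_measure_le t m :
  is_measure t -> ca_measure m -> mle t m -> ca_measure t.
Proof.
move=> tm [mm mca] le_tm; split=> //.
apply/(completely_additiveP _ tm) => T a x r ax sum_le.
have mt := measureB _ _ mm tm le_tm.
suff : m x <= r + (m x - t x) by lra.
apply: ((completely_additiveP _ mm).1 mca _ _ _ _ ax) => F.
have := measure_sum_le _ _ _ _ F mt ax; rewrite sumrB.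
by have := sum_le F; lra.
Qed.

(** * The join of two measures *)

Definition measure_join_set t1 t2 x : set R :=
  [set t1 ab.1 + t2 ab.2 | ab in [set ab : E * E | eadd ab.1 ab.2 = Some x]].

Definition measure_join t1 t2 x : R := sup (measure_join_set t1 t2 x).

Section Join.
Variables t1 t2 : E -> R.
Hypotheses (tm1 : is_measure t1) (tm2 : is_measure t2).

Lemma measure_join_set_neq0 x : measure_join_set t1 t2 x !=set0.
Proof.
by exists (t1 x + t2 ezero); exists (x, ezero) => //=; exact: eadd0.
Qed.

Lemma measure_join_has_ubound x : has_ubound (measure_join_set t1 t2 x).
Proof.
exists (t1 x + t2 x) => _ [[a b] /= ab <-].
apply: lerD; apply: measure_ele => //; first by exists b.
by exists a; rewrite eaddC.
Qed.

Lemma measure_join_ge a b x :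
  eadd a b = Some x -> t1 a + t2 b <= measure_join t1 t2 x.
Proof.
move=> ab; apply: ub_le_sup; first exact: measure_join_has_ubound.
by exists (a, b).
Qed.

Lemma measure_join_le m : is_measure m ->
  mle t1 m -> mle t2 m -> mle (measure_join t1 t2) m.
Proof.
move=> mm le1 le2 x; apply: ge_sup; first exact: measure_join_set_neq0.
by move=> _ [[a b] /= /mm.2 -> <-]; exact: lerD.
Qed.

Lemma measure_join_gel : mle t1 (measure_join t1 t2).
Proof.
move=> x; rewrite -[t1 x]addr0 -(measure0 _ tm2).
by apply: measure_join_ge; exact: eadd0.
Qed.

Lemma measure_join_ger : mle t2 (measure_join t1 t2).
Proof.
move=> x; rewrite -[t2 x]add0r -(measure0 _ tm1).
by apply: measure_join_ge; rewrite eaddC; exact: eadd0.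
Qed.

Lemma measure_join_measure : rdp E -> is_measure (measure_join t1 t2).
Proof.
move=> hE; split=> [a|x1 x2 x x12].
  exact: le_trans (tm1.1 a) (measure_join_gel a).
apply/eqP; rewrite eq_le; apply/andP; split.
  apply: ge_sup; first exact: measure_join_set_neq0.
  move=> _ [[a b] /= ab <-].
  (* Subadditivity: (RDP) refines [a + b = x1 + x2], so that [d1 + d3] splits [x1] and [d2 + d4]
     splits [x2]. *)
  have [d1 [d2 [d3 [d4 [e1 e2 e3 e4]]]]] := hE _ _ _ _ _ ab x12.
  rewrite (tm1.2 _ _ _ e1) (tm2.2 _ _ _ e2) addrACA.
  by apply: lerD; exact: measure_join_ge.
(* Superadditivity: the two suprema are removed one at a time, leaving arbitrary splittings of [x1]
   and [x2] to be merged. *)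
rewrite -lerBrDr; apply: ge_sup; first exact: measure_join_set_neq0.
move=> _ [[a1 b1] /= e1 <-]; rewrite lerBrDl -lerBrDr.
apply: ge_sup; first exact: measure_join_set_neq0.
move=> _ [[a2 b2] /= e2 <-]; rewrite lerBrDl.
have [a [b [ea eb e]]] := eadd_interchange _ e1 e2 x12.
by rewrite addrACA -(tm1.2 _ _ _ ea) -(tm2.2 _ _ _ eb) measure_join_ge.
Qed.

End Join.

Lemma ca_measure_join t1 t2 : rdp E -> ca_measure t1 -> ca_measure t2 ->
  ca_measure (measure_join t1 t2).
Proof.
move=> hE ca1 ca2; apply: (ca_measure_le _ (fun a => t1 a + t2 a)).
- by apply: measure_join_measure => //; [exact: ca1.1|exact: ca2.1].
- exact: ca_measureD.
- apply: measure_join_le => [|a|a].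
  + exact: measureD ca1.1 ca2.1.
  + by rewrite lerDl ca2.1.1.
  + by rewrite lerDr ca1.1.1.
Qed.

(** * The largest completely additive measure below a given one *)

Definition ca_below m : set (E -> R) := [set t | ca_measure t /\ mle t m].

Definition ca_part m x : R := sup [set t x | t in ca_below m].

Section CaPart.
Variable m : E -> R.
Hypothesis mm : is_measure m.

Lemma ca_part_set_neq0 x : [set t x | t in ca_below m] !=set0.
Proof.
by exists 0, (fun=> 0) => //; split; [exact: ca_measure_cst0 | exact: mm.1].
Qed.

Lemma ca_part_ge t : ca_measure t -> mle t m -> mle t (ca_part m).
Proof.
move=> ca_t le_tm x; apply: ub_le_sup; last by exists t.
by exists (m x) => _ [t' [_ le_t'm] <-]; exact: le_t'm.
Qed.

Lemma ca_part_lub x r :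
  (forall t, ca_measure t -> mle t m -> t x <= r) -> ca_part m x <= r.
Proof.
move=> ub; apply: ge_sup; first exact: ca_part_set_neq0.
by move=> _ [t [ca_t le_tm] <-]; exact: ub.
Qed.

Lemma ca_part_le : mle (ca_part m) m.
Proof. by move=> x; apply: ca_part_lub => t _; apply. Qed.

Lemma ca_part_measure : rdp E -> is_measure (ca_part m).
Proof.
move=> hE; split=> [a|a b c abc].
  exact: ca_part_ge ca_measure_cst0 mm.1 a.
apply/eqP; rewrite eq_le; apply/andP; split.
  apply: ca_part_lub => t ca_t le_tm; rewrite (ca_t.1.2 _ _ _ abc).
  by apply: lerD; exact: ca_part_ge.
rewrite -lerBrDr; apply: ca_part_lub => t1 ca1 le1.
rewrite lerBrDl -lerBrDr; apply: ca_part_lub => t2 ca2 le2; rewrite lerBrDl.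
(* Different measures may be used at [a] and at [b]; their join serves for both. *)
have ca12 := ca_measure_join _ _ hE ca1 ca2.
apply: (@le_trans _ _ (measure_join t1 t2 c)).
  by apply: measure_join_ge abc; [exact: ca1.1 | exact: ca2.1].
by apply: ca_part_ge => //; exact: measure_join_le.
Qed.

(** A bound on the partial sums of [ca_part m] also bounds those of every competitor [t], hence
    [t x], hence the supremum. *)
Lemma ca_part_ca : rdp E -> ca_measure (ca_part m).
Proof.
move=> hE; have mp := ca_part_measure hE; split=> //.
apply/(completely_additiveP _ mp) => T a x r ax sum_le.
apply: ca_part_lub => t ca_t le_tm.
apply: ((completely_additiveP _ ca_t.1).1 ca_t.2 _ _ _ _ ax) => F.
apply: le_trans (sum_le F); apply: ler_sum => i _; exact: ca_part_ge.
Qed.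

Lemma ca_part_compl_free :
  rdp E -> ca_free_measure (fun a => m a - ca_part m a).
Proof.
move=> hE; have ca_p := ca_part_ca hE.
split=> [|t ca_t le_t]; first exact: measureB ca_p.1 ca_part_le.
have le_tp : mle (fun a => ca_part m a + t a) (ca_part m).
  apply: ca_part_ge; first exact: ca_measureD.
  by move=> a; have := le_t a; lra.
apply/funext => a; have := le_tp a; have := ca_t.1.1 a; lra.
Qed.

Lemma ca_part_unique n1 n2 : rdp E ->
  ca_measure n1 -> ca_free_measure n2 -> m = (fun a => n1 a + n2 a) ->
  n1 = ca_part m /\ n2 = (fun a => m a - ca_part m a).
Proof.
move=> hE ca1 [mn2 free2] m_eq; have ca_p := ca_part_ca hE.
have le1 : mle n1 (ca_part m).
  by apply: ca_part_ge => // a; rewrite m_eq lerDl mn2.1.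
have md := measureB _ _ ca_p.1 ca1.1 le1.
(* The difference is below [n2 = m - n1] because [ca_part m] is below [m], and it is completely
   additive because it is below [ca_part m]. *)
have d0 : (fun a => ca_part m a - n1 a) = (fun=> 0).
  apply: free2.
    apply: ca_measure_le md ca_p _ => a.
    by rewrite gerBl ca1.1.1.
  by move=> a; have := ca_part_le a; have /= := congr1 (@^~ a) m_eq; lra.
have n1E : n1 = ca_part m.
  by apply/funext => a; have := congr1 (@^~ a) d0; rewrite /=; lra.
split=> //; rewrite -n1E; apply/funext => a.
by have /= := congr1 (@^~ a) m_eq; lra.
Qed.

End CaPart.

(** * Passing between measures and states *)

Lemma state_normalize m : is_measure m -> 0 < m eone ->
  is_state (fun a => (m eone)^-1 * m a).
Proof.
move=> mm m1; split; last by rewrite mulVf ?gt_eqF.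
by apply: measureZ => //; rewrite invr_ge0 ltW.
Qed.

Lemma ca_state_normalize m : ca_measure m -> 0 < m eone ->
  ca_state (fun a => (m eone)^-1 * m a).
Proof.
move=> cam m1; split; first exact: state_normalize cam.1 m1.
by apply: (ca_measureZ _ _ _ cam).2; rewrite invr_ge0 ltW.
Qed.

Lemma ca_free_state_normalize m : ca_free_measure m -> 0 < m eone ->
  ca_free_state (fun a => (m eone)^-1 * m a).
Proof.
move=> [mm free] m1; split=> [|s k cas k0 le_s]; first exact: state_normalize.
have /(congr1 (@^~ eone)) /eqP : (fun a => m eone * k * s a) = (fun=> 0).
  apply: free => [|a].
    apply: ca_measureZ; first by rewrite mulr_ge0 // ltW.
    by split; [exact: cas.1.1 | exact: cas.2].
  by rewrite -mulrA -ler_pdivlMl //; exact: le_s.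
by rewrite cas.1.2 mulr1 mulf_eq0 gt_eqF //= => /eqP.
Qed.

Lemma ca_measure_state (k : R) s : 0 <= k -> (0 < k -> ca_state s) ->
  ca_measure (fun a => k * s a).
Proof.
rewrite le_eqVlt => /predU1P[<- _|k0 /(_ k0) cas].
  by under eq_fun do rewrite mul0r; exact: ca_measure_cst0.
by apply: ca_measureZ; [exact: ltW | split; [exact: cas.1.1|exact: cas.2]].
Qed.

Lemma ca_free_measure_state (k : R) s : 0 <= k -> (0 < k -> ca_free_state s) ->
  ca_free_measure (fun a => k * s a).
Proof.
rewrite le_eqVlt => /predU1P[<- _|k0 /(_ k0) [ss free]].
  under eq_fun do rewrite mul0r; split; first exact: measure_cst0.
  move=> t cat le_t; apply/funext => a; apply/eqP.
  by rewrite eq_le le_t cat.1.1.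
split=> [|t cat le_t]; first exact: measureZ (ltW k0) ss.1.
apply: measure1_eq0; first exact: cat.1.
apply/eqP; rewrite eq_le cat.1.1 andbT leNgt; apply/negP => t1.
(* If [t] had positive mass, its normalisation would be a completely additive state whose multiple
   by [k^-1 * t eone] lies below [s]. *)
suff /eqP : k^-1 * t eone = 0 by rewrite mulf_eq0 invr_eq0 !gt_eqF.
apply: free (ca_state_normalize _ cat t1) _ _ => [|a].
  by rewrite mulr_ge0 ?invr_ge0 ?ltW.
by rewrite -mulrA mulVKf ?gt_eqF // ler_pdivrMl.
Qed.

(** At mass 0 the inverse is 0 by convention, but then [m] itself vanishes. *)
Lemma measure_normalizeK m :
  is_measure m -> (fun a => m eone * ((m eone)^-1 * m a)) = m.
Proof.
move=> mm; have [m1|m1] := eqVneq (m eone) 0.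
  by rewrite (measure1_eq0 _ mm m1); apply/funext => a; rewrite mul0r.
by apply/funext => a; rewrite mulVKf.
Qed.

(* If [k = 0] then [s] need not be a state, but the mass at [1] is still [k]. *)
Lemma scaled_state_mass (k : R) s m : 0 <= k -> (0 < k -> s eone = 1) ->
  (fun a => k * s a) = m ->
  k = m eone /\ (0 < m eone -> s = (fun a => (m eone)^-1 * m a)).
Proof.
move=> k0 s1 <-; have -> : k * s eone = k.
  by move: k0; rewrite le_eqVlt => /predU1P[<-|/s1 ->]; rewrite ?mul0r ?mulr1.
by split=> // kpos; apply/funext => a; rewrite mulKf ?gt_eqF.
Qed.

End MeasureTheory.

Theorem theorem4p4 (R : realType) (E : effectAlgebraType) (hE : rdp E) :
  (forall m : E -> R, is_measure m ->
     exists! mm : (E -> R) * (E -> R),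
       [/\ ca_measure mm.1, ca_free_measure mm.2 &
           m = (fun a => mm.1 a + mm.2 a)]) /\
  (forall s : E -> R, is_state s ->
     exists (l1 l2 : R) (s1 s2 : E -> R),
       ca_convex_decomposition s l1 l2 s1 s2 /\
       forall (k1 k2 : R) (t1 t2 : E -> R),
         ca_convex_decomposition s k1 k2 t1 t2 ->
         [/\ k1 = l1, k2 = l2, 0 < l1 -> t1 = s1 & 0 < l2 -> t2 = s2]).
Proof.
split=> [m mm|s [sm s1]].
  exists (ca_part m, fun a => m a - ca_part m a); split.
    split; [exact: ca_part_ca | exact: ca_part_compl_free |].
    by apply/funext => a /=; rewrite addrC subrK.
  move=> [n1 n2] [/= ca1 free2 m_eq].
  by have [-> ->] := ca_part_unique _ mm _ _ hE ca1 free2 m_eq.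
pose m1 := ca_part s; pose m2 a := s a - m1 a.
have ca1 : ca_measure m1 by exact: ca_part_ca.
have free2 : ca_free_measure m2 by exact: ca_part_compl_free.
exists (m1 eone), (m2 eone).
(* A part of mass 0 yields the zero function, which is no state; its coefficient is then 0, so none
   is required. *)
exists (fun a => (m1 eone)^-1 * m1 a), (fun a => (m2 eone)^-1 * m2 a).
split.
  split; split.
  - exact: ca1.1.1.
  - exact: free2.1.1.
  - by rewrite /m2 s1 addrC subrK.
  - exact: ca_state_normalize.
  - exact: ca_free_state_normalize.
  - apply/funext => a.
    have /(congr1 (@^~ a)) /= -> := measure_normalizeK _ ca1.1.
    have /(congr1 (@^~ a)) /= -> := measure_normalizeK _ free2.1.
    by rewrite /m2 addrC subrK.
move=> k1 k2 t1 t2 [[k1_ge0 k2_ge0 _] [ca_t1 free_t2 s_eq]].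
(* The scaled terms decompose [s] as a measure, so they are [m1] and [m2]; coefficients and states
   are then read off from the masses at 1. *)
have [k1t1 k2t2] := ca_part_unique _ sm _ _ hE
  (ca_measure_state _ _ k1_ge0 ca_t1) (ca_free_measure_state _ _ k2_ge0 free_t2) s_eq.
have [k1E t1E] := scaled_state_mass _ _ _ k1_ge0 (fun h => (ca_t1 h).1.2) k1t1.
have [k2E t2E] := scaled_state_mass _ _ _ k2_ge0 (fun h => (free_t2 h).1.2) k2t2.
by split.
Qed.
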